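(* Let $(d_k,d_{k-1},\ldots,d_0)_b$ be an $(n,b)$-palintiple that is either a 1089 palintiple or shifted-symmetric, and let $\xi\in\mathbb{C}$, $\xi\neq b$, be a non-zero root of the palinomial $\mathrm{Pal}(x)$ it induces. Then $\xi$ is a root of both the digit polynomial and the reverse-digit polynomial, that is, $$\sum_{j=0}^{k}d_j\xi^j=\sum_{j=0}^{k}d_{k-j}\xi^j=0.$$
   Context: For integers $1<n<b$ and $k\ge 1$, write $(d_k,\ldots,d_0)_b=\sum_{j=0}^k d_jb^j$ with digits $0\le d_j<b$. It is called a $(k+1)$-digit $(n,b)$-palintiple (with multiplier $n$ and base $b$) if $d_k\neq 0$ (no leading zeros) and $(d_k,d_{k-1},\ldots,d_0)_b=n\,(d_0,d_1,\ldots,d_k)_b$. Its carries $c_k,\ldots,c_0$ are those of the base-$b$ single-digit multiplication: $c_0=0$ and $n d_{k-j}+c_j=d_j+b\,c_{j+1}$ for $0\le j\le k$, with $c_{k+1}=0$. The palintiple is shifted-symmetric if $c_j=c_{k-j+1}$ for all $0\le j\le k$. A 1089 $(n,b)$-palintiple is an $(n,b)$-palintiple whose Young graph $Y(n,b)$ is isomorphic to $Y(9,10)$; by a theorem of Kendrick this is equivalent to the condition that $n+1$ divides $b$, which may be taken as the definition here. The palinomial induced by an $(n,b)$-palintiple $(d_k,\ldots,d_0)_b$ is $\mathrm{Pal}(x)=\sum_{j=0}^k(d_j-nd_{k-j})x^j$. *)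

(* Defs.v *)
From mathcomp Require Import all_boot all_order all_algebra.
From mathcomp Require Import reals complex.

Set Implicit Arguments.
Unset Strict Implicit.
Unset Printing Implicit Defensive.

(* A digit string (d_k, ..., d_0) is a function d : nat -> nat together with k;
   the values of d beyond k are never used. *)
Definition base_value (b k : nat) (d : nat -> nat) : nat :=
  \sum_(j < k.+1) d j * b ^ j.

Definition palintiple (n b k : nat) (d : nat -> nat) : Prop :=
  [/\ 1 < n < b, 1 <= k, forall j, j <= k -> d j < b, d k != 0
    & base_value b k d = n * base_value b k (fun j => d (k - j))].

(* The carry c_j of the schoolbook multiplication of (d_0, ..., d_k)_b by n:
   the digit in position j of the multiplicand is d_(k-j). *)
Fixpoint carry (n b k : nat) (d : nat -> nat) (j : nat) : nat :=
  if j is i.+1 then (n * d (k - i) + carry n b k d i) %/ b else 0.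

Definition shifted_symmetric (n b k : nat) (d : nat -> nat) : Prop :=
  forall j, j <= k -> carry n b k d j = carry n b k d (k - j + 1).

(* Of an (n,b)-palintiple: Y(n,b) is isomorphic to Y(9,10) if and only if
   n + 1 divides b (Kendrick); the latter is taken as the definition. *)
Definition is_1089 (n b : nat) : Prop := n + 1 %| b.

Definition palinomial (n k : nat) (d : nat -> nat) : {poly int} :=
  (\poly_(j < k.+1) ((d j)%:Z - n%:Z * (d (k - j)%N)%:Z))%R.

Lemma base_value_lt b m (u : nat -> nat) :
  (forall j, j < m -> u j < b) -> \sum_(j < m) u j * b ^ j < b ^ m.
Proof.
elim: m => [|m IHm] ltu; first by rewrite big_ord0.
rewrite big_ord_recr /= expnS.
apply: (@leq_trans (b ^ m + u m * b ^ m)).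
  by rewrite ltn_add2r IHm // => j ltjm; apply: ltu; apply: ltnW.
by rewrite -mulSn leq_mul2r ltu ?orbT.
Qed.

Lemma base_value_inj b m (u v : nat -> nat) C :
    (forall j, j < m -> u j < b) -> (forall j, j < m -> v j < b) ->
    \sum_(j < m) u j * b ^ j + C * b ^ m = \sum_(j < m) v j * b ^ j ->
  C = 0 /\ forall j, j < m -> u j = v j.
Proof.
elim: m C => [|m IHm] C ltu ltv.
  by rewrite !big_ord0 muln1 add0n => ->.
have ltu' j : j < m -> u j < b by move=> ltjm; apply: ltu; apply: ltnW.
have ltv' j : j < m -> v j < b by move=> ltjm; apply: ltv; apply: ltnW.
rewrite !big_ord_recr /= expnS mulnA -addnA -mulnDl.
have ltum := base_value_lt ltu'; have ltvm := base_value_lt ltv'.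
have bm_gt0 : 0 < b ^ m by apply: leq_ltn_trans ltum.
move=> eq_uv.
have /(congr1 (divn^~ (b ^ m))) := eq_uv.
rewrite !divnDMl // !divn_small // !add0n => eqm.
have C0 : C = 0.
  have := ltv m (ltnSn m); rewrite -eqm.
  by case: (C) => // C'; rewrite mulSn addnCA ltnNge leq_addr.
move: eqm eq_uv; rewrite C0 mul0n addn0 => eqm; rewrite eqm => /addIn eq_uv.
have [_ eqj] := IHm 0 ltu' ltv' (etrans (addn0 _) eq_uv).
by split=> // j; rewrite ltnS leq_eqVlt => /predU1P[->|/eqj].
Qed.

(* For a palintiple, [carry] is the solution of the carry equations. *)
Lemma carryP n b k d : palintiple n b k d ->
  [/\ carry n b k d 0 = 0, carry n b k d k.+1 = 0
    & forall j, j <= k ->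
        n * d (k - j) + carry n b k d j = d j + b * carry n b k d j.+1].
Proof.
case=> /andP[n_gt1 ltnb] _ ltd _ pal.
have b_gt0 : 0 < b by apply: ltn_trans ltnb; apply: ltnW.
pose u j := (n * d (k - j) + carry n b k d j) %% b.
have mulE m : \sum_(j < m) u j * b ^ j + carry n b k d m * b ^ m
    = n * \sum_(j < m) d (k - j) * b ^ j.
  elim: m => [|m IHm]; first by rewrite !big_ord0 muln0.
  rewrite !big_ord_recr /= mulnDr -IHm expnS mulnA -addnA -mulnDl.
  rewrite (addnC (u m)) -divn_eq mulnDl mulnA -addnA.
  by congr (_ + _); rewrite addnC.
have ltu j : j < k.+1 -> u j < b by rewrite ltn_mod.
have [c0 eq_ud] := base_value_inj ltu ltd (etrans (mulE k.+1) (esym pal)).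
split=> // j lejk; rewrite [LHS](divn_eq _ b) -/(u j) eq_ud //.
by rewrite addnC mulnC.
Qed.

(* Main.v *)
Require Import Defs.
From mathcomp Require Import all_boot all_order all_algebra.
From mathcomp Require Import reals complex.
From mathcomp Require Import zify.

(** The carries determine everything.  Write D and E for the values at xi of
    the digit and reverse-digit polynomials, and C, C' for the values at xi of
    the sums of c_j x^j and of c_(j+1) x^j, over 0 <= j <= k.  As
    c_0 = c_(k+1) = 0, shifting the index gives C = xi C'.  Summing the carry
    equations n d_(k-j) + c_j = d_j + b c_(j+1) against xi^j gives
      n E + C = D + b C',
    so that Pal(xi) = D - n E = (xi - b) C'.  A root xi <> b thus
    kills C', hence also C, and D = n E.

    The same equations read at k - j give n D + B = E + b xi B, where B is the
    value at xi of the sum of c_(k-j) x^j.  So once B = 0, also E = n D, whence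
    (n^2 - 1) E = 0 and D = E = 0.

    A symmetry of the carries gives B = 0: if c is shifted-symmetric, then
    c_(k-j) = c_(j+1) and B = C'.  If n + 1 divides b, then c is symmetric,
    c_(k-j) = c_j ([is_1089_carry_sym]), and B = C. *)

Import GRing.Theory Num.Theory.
Local Open Scope ring_scope.

Lemma sum_shift_index (A : comPzRingType) (m : nat) (u : nat -> nat) (x : A) :
    u 0%N = 0%N -> u m = 0%N ->
  \sum_(j < m) (u j)%:R * x ^+ j = x * \sum_(j < m) (u j.+1)%:R * x ^+ j.
Proof.
case: m => [|m] u0 um; first by rewrite !big_ord0 mulr0.
rewrite big_ord_recl [in RHS]big_ord_recr /= u0 um !mul0r add0r addr0.
by rewrite mulr_sumr; apply: eq_bigr => j _; rewrite exprS mulrCA.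
Qed.

Lemma carry_lt (n b k : nat) (d : nat -> nat) (j : nat) :
  (0 < n)%N -> (forall i, (i <= k)%N -> (d i < b)%N) -> (carry n b k d j < n)%N.
Proof.
move=> n_gt0 ltd; elim: j => [//|j IHj] /=.
have ltdj : (d (k - j) < b)%N by apply: ltd; rewrite leq_subr.
rewrite ltn_divLR; last exact: leq_ltn_trans ltdj.
by have := leq_mul (leqnn n) ltdj; rewrite mulnS; lia.
Qed.

(** Modulo n + 1 one has n = -1 and b = 0, so the carry equations at j and at
    k - j both say that the carry is d_j + d_(k-j); the two carries, being less
    than n, are then equal. *)
Lemma is_1089_carry_sym (n b k : nat) (d : nat -> nat) :
    palintiple n b k d -> is_1089 n b ->
  forall j, (j <= k)%N -> carry n b k d (k - j) = carry n b k d j.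
Proof.
move=> pal n1_dvd_b.
have [_ _ carryE] := carryP pal; case: (pal) => /andP[n_gt1 _] _ ltd _ _.
have carry_mod i : (i <= k)%N ->
    carry n b k d i = d i + d (k - i)%N %[mod n + 1].
  move=> leik; apply/eqP; rewrite -(eqn_modDl (n * d (k - i)%N)) carryE //.
  (* both sides are d_i modulo n + 1 *)
  rewrite -modnDmr (eqP (dvdn_mulr _ n1_dvd_b)) addn0.
  rewrite (_ : (_ + (d i + _) = d (k - i) * (n + 1) + d i)%N); last by lia.
  by rewrite modnMDl.
move=> j lejk; have lt_n1 i : (carry n b k d i < n + 1)%N.
  by rewrite addn1 ltnS ltnW // carry_lt // ltnW.
rewrite -(modn_small (lt_n1 (k - j)%N)) -[RHS](modn_small (lt_n1 j)).
by rewrite !carry_mod ?leq_subr // subKn // addnC.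
Qed.

Theorem theorem9 (R : realType) (n b k : nat) (d : nat -> nat) (xi : R[i])
    (hpal : palintiple n b k d)
    (htype : is_1089 n b \/ shifted_symmetric n b k d)
    (hxib : xi != b%:R) (hxi0 : xi != 0)
    (hroot : root (map_poly intr (palinomial n k d)) xi) :
  \sum_(j < k.+1) (d j)%:R * xi ^+ j = 0 /\
  \sum_(j < k.+1) (d (k - j)%N)%:R * xi ^+ j = 0.
Proof.
have [c0 ck1 carryE] := carryP hpal; have [/andP[n_gt1 _] _ _ _ _] := hpal.
set c := carry n b k d in c0 ck1 carryE.
set D := \sum_(j < k.+1) (d j)%:R * xi ^+ j.
set E := \sum_(j < k.+1) (d (k - j)%N)%:R * xi ^+ j.
pose C := \sum_(j < k.+1) (c j)%:R * xi ^+ j.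
pose C' := \sum_(j < k.+1) (c j.+1)%:R * xi ^+ j.
pose B := \sum_(j < k.+1) (c (k - j)%N)%:R * xi ^+ j.
have CE : C = xi * C' by apply: sum_shift_index.
have sum_carry : n%:R * E + C = D + b%:R * C'.
  rewrite /C /C' /D /E !mulr_sumr -!big_split; apply: eq_bigr => j _ /=.
  rewrite !mulrA -!mulrDl -!natrM -!natrD carryE //.
  by rewrite -ltnS.
have sum_carry_rev : n%:R * D + B = E + b%:R * (xi * B).
  (* the index shift for the reversed carries c_(k+1-j) *)
  rewrite -(@sum_shift_index _ k.+1 (fun j => c (k.+1 - j)%N)); first last.
  - by rewrite subnn.
  - by rewrite subn0.
  rewrite /B /D /E !mulr_sumr -!big_split; apply: eq_bigr => j _ /=.
  have lejk : (j <= k)%N by rewrite -ltnS.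
  rewrite !mulrA -!mulrDl -!natrM -!natrD subSn // -carryE ?leq_subr //.
  by rewrite subKn.
have palE : D - n%:R * E = 0.
  have /eqP <- := hroot.
  rewrite /palinomial poly_def rmorph_sum horner_sum /D /E mulr_sumr -sumrB.
  apply: eq_bigr => j _.
  rewrite /= map_polyZ map_polyXn hornerZ hornerXn rmorphB rmorphM /=.
  by rewrite mulrBl mulrA.
have C'0 : C' = 0.
  have /eqP : (xi - b%:R) * C' = 0.
    rewrite mulrBl -CE -palE -(addrK (b%:R * C') D) -sum_carry.
    by rewrite [_ + C]addrC [in RHS]addrAC addrK.
  by rewrite mulf_eq0 subr_eq0 (negPf hxib) => /eqP.
have C0 : C = 0 by rewrite CE C'0 mulr0.
have B0 : B = 0.
  case: htype => [n1_dvd_b | shift_sym].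
    rewrite -C0; apply: eq_bigr => j _.
    by rewrite /c (is_1089_carry_sym _ _ _ _ hpal n1_dvd_b) // -ltnS.
  rewrite -C'0; apply: eq_bigr => j _.
  have lejk : (j <= k)%N by rewrite -ltnS.
  by rewrite /c shift_sym ?leq_subr // subKn // addn1.
have DE : D = n%:R * E by apply/eqP; rewrite -subr_eq0 palE.
have ED : E = n%:R * D by have := sum_carry_rev; rewrite B0 !mulr0 !addr0.
have E0 : E = 0.
  have /eqP : (n%:R ^+ 2 - 1) * E = 0
    by rewrite mulrBl mul1r expr2 -mulrA -DE -ED subrr.
  rewrite mulf_eq0 subr_eq0 -natrX pnatr_eq1 (eqn_sqr n 1).
  by rewrite gtn_eqF // => /eqP.
by rewrite DE E0 mulr0.
Qed.
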